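(* There is a constant $c$ with $0<c\le 7$ such that for every constant $\Delta$ there is a constant $C_\Delta$ such that every undirected graph $G=(V,E)$ on $n$ vertices with maximum degree at most $\Delta$ admits a hub labeling $\{S_v\}$ with total size $$\sum_{v\in V}|S_v|\le C_\Delta\cdot\frac{n^2}{\mathsf{RS}(n)^{1/c}}.$$ (The same holds when edges have weights in $\{0,1\}$, distances being weighted.)
   Context: A hub labeling of a graph $G=(V,E)$ is a family of sets $S_v\subseteq V$, $v\in V$, such that for every pair $u,v$ at finite distance there is $w\in S_u\cap S_v$ with $\mathrm{dist}(u,w)+\mathrm{dist}(w,v)=\mathrm{dist}(u,v)$. A matching $M\subseteq E(G)$ is induced if there is $V'\subseteq V(G)$ such that $M$ is exactly the edge set of the subgraph induced by $V'$. A Ruzsa–Szemerédi graph is an undirected unweighted graph on $n$ vertices whose edges can be partitioned into at most $n$ induced matchings; $\mathsf{RS}(n)$ is the largest value such that every Ruzsa–Szemerédi graph on $n$ vertices has at most $n^2/\mathsf{RS}(n)$ edges. *)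

(* Defs.v *)
From mathcomp Require Import all_boot.
From Stdlib Require Import Reals.

Set Implicit Arguments.
Unset Strict Implicit.
Unset Printing Implicit Defensive.

(* Edge weights w (only relevant on edges); unweighted graphs are the   *)
(* special case w = 1.                                                  *)

Definition walk_weight n (w : 'I_n -> 'I_n -> nat) (u : 'I_n) (p : seq 'I_n) : nat :=
  sumn (pairmap w u p).

Definition is_walk n (e : rel 'I_n) (u v : 'I_n) (p : seq 'I_n) : Prop :=
  path e u p /\ last u p = v.

(* d is the (weighted) distance from u to v: it is the weight of some walk
   from u to v and no walk from u to v is lighter.  (Only holds for some d
   when u and v are at finite distance.) *)
Definition is_dist n (e : rel 'I_n) (w : 'I_n -> 'I_n -> nat) (u v : 'I_n) (d : nat) : Prop :=
  (exists p, is_walk e u v p /\ walk_weight w u p = d) /\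
  (forall p, is_walk e u v p -> (d <= walk_weight w u p)%N).

Definition hub_labeling n (e : rel 'I_n) (w : 'I_n -> 'I_n -> nat)
    (S : 'I_n -> {set 'I_n}) : Prop :=
  forall u v : 'I_n, connect e u v ->
    exists z : 'I_n, [/\ z \in S u, z \in S v &
      exists a b d, [/\ is_dist e w u z a, is_dist e w z v b, is_dist e w u v d
                      & (a + b)%N = d]].

Definition total_size n (S : 'I_n -> {set 'I_n}) : nat := (\sum_(v : 'I_n) #|S v|)%N.

Definition max_degree_le n (e : rel 'I_n) (D : nat) : Prop :=
  forall v : 'I_n, (#|[set u | e v u]| <= D)%N.

(* Ruzsa–Szemerédi graphs.  A graph on 'I_n is an edge indicator         *)
(* g : {ffun 'I_n * 'I_n -> bool} (symmetric, loopless). It is RS if its *)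
(* edges can be partitioned into at most n induced matchings: a symmetric*)
(* colouring f of the edges with colours in 'I_n such that each colour   *)
(* class is a matching that equals the edge set of the subgraph induced  *)
(* by some vertex set V'. (Empty classes are allowed, so "at most n".)   *)

Definition is_simple_graph n (g : {ffun 'I_n * 'I_n -> bool}) : bool :=
  [forall x : 'I_n, ~~ g (x, x)] && [forall x : 'I_n, forall y : 'I_n, g (x, y) == g (y, x)].

Definition induced_matching_class n (g : {ffun 'I_n * 'I_n -> bool})
    (f : {ffun 'I_n * 'I_n -> 'I_n}) (k : 'I_n) : bool :=
  [forall x : 'I_n, forall y : 'I_n, forall z : 'I_n,
     [&& g (x, y), g (x, z), f (x, y) == k & f (x, z) == k] ==> (y == z)] &&
  [exists V : {set 'I_n}, forall x : 'I_n, forall y : 'I_n,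
     (g (x, y) && (f (x, y) == k)) == [&& x \in V, y \in V & g (x, y)]].

Definition is_RS_graph n (g : {ffun 'I_n * 'I_n -> bool}) : bool :=
  is_simple_graph g &&
  [exists f : {ffun 'I_n * 'I_n -> 'I_n},
     [forall x : 'I_n, forall y : 'I_n, f (x, y) == f (y, x)] &&
     [forall k : 'I_n, induced_matching_class g f k]].

Definition num_edges n (g : {ffun 'I_n * 'I_n -> bool}) : nat :=
  #|[set p : 'I_n * 'I_n | (p.1 < p.2)%N && g p]|.

Definition max_RS_edges (n : nat) : nat :=
  (\max_(g : {ffun 'I_n * 'I_n -> bool} | is_RS_graph g) num_edges g)%N.

(* RS(n) = n^2 / (max #edges of an RS graph on n vertices); the max is
   replaced by 1 when it is 0 (n <= 1). *)
Definition RS (n : nat) : R :=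
  Rdiv (Rmult (INR n) (INR n)) (INR (maxn 1 (max_RS_edges n))).

(* Main.v *)
(* Write H(u,v) for the set of vertices on shortest u-v paths. With q maximal such
   that q^28 <= RS(n), set T = q^5. A hitting set of size O(n / q^4) meets H(u,v)
   for all but n^2 / q^4 of the pairs with |H(u,v)| >= T, and some colouring with
   T^2 q^4 colours is injective on H(u,v) for all but n^2 / q^4 of the pairs with
   |H(u,v)| < T; both kinds of exceptional pairs are stored directly. For each vertex x
   and distances a, b < T, take a maximal matching M of the remaining pairs (u,v) with
   x in H(u,v), d(u,x) = a, d(x,v) = b, and give x to the endpoints of M, so that each
   x in H(u,v) is given to u or to v. Hence on a shortest u-v path some vertex given to
   u is followed by one given to v (or a single one serves both), and adding the
   neighbours of all given vertices yields a common hub. For fixed a, b and a fixed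
   colour, injectivity makes these matchings induced in their union once it is
   restricted to a bipartition, so their total size is at most 4 n^2 / RS(n). There are
   T^2 choices of (a, b) and T^2 q^4 colours, and T^4 q^4 / RS(n) <= q^-4. *)
Require Import Defs.
From mathcomp Require Import all_boot zify.
From Stdlib Require Import Reals Lra ClassicalEpsilon.
(* Reals rebinds [^] on nat to Nat.pow; this restores ssrnat's [expn]. *)
From mathcomp Require Import ssrnat.

Set Implicit Arguments.
Unset Strict Implicit.
Unset Printing Implicit Defensive.

(** * Averaging and counting of functions *)

Lemma leq_average (X : finType) (x0 : X) (F : X -> nat) :
  exists x, #|X| * F x <= \sum_y F y.
Proof.
exists [arg min_(x < x0) F x]; case: arg_minnP => // x _ le_x.
by rewrite -sum_nat_const leq_sum.
Qed.

Lemma geq_average (X : finType) (x0 : X) (F : X -> nat) :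
  exists x, \sum_y F y <= #|X| * F x.
Proof.
exists [arg max_(x > x0) F x]; case: arg_maxnP => // x _ le_x.
by rewrite -sum_nat_const leq_sum.
Qed.

Lemma sum_card_exchange (X Y : finType) (A : {pred X}) (B : X -> {pred Y}) :
  \sum_(x in A) #|B x| = \sum_y #|[set x in A | y \in B x]|.
Proof.
under eq_bigr do rewrite -sum1_card.
rewrite (exchange_big_dep predT) //=; apply: eq_bigr => y _.
by rewrite -sum1_card; apply: eq_bigl => x; rewrite inE.
Qed.

(** The functions form a product family with two singleton factors. The product form avoids division
    and a truncated exponent. *)
Lemma card_ffun_fix2 (X C : finType) (x y : X) (c d : C) : x != y ->
  #|[set f : {ffun X -> C} | (f x == c) && (f y == d)]| * #|C| ^ 2 = #|C| ^ #|X|.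
Proof.
move=> xy; pose F z : pred C :=
  if z == x then pred1 c else if z == y then pred1 d else predT.
have -> : #|[set f : {ffun X -> C} | (f x == c) && (f y == d)]| = #|finfun.family F|.
  apply: eq_card => f; rewrite inE; apply/andP/familyP => [[/eqP fx /eqP fy] z|fF].
    rewrite /F; case: eqP => [->|_]; first by rewrite inE fx.
    by case: eqP => [->|_]; rewrite inE ?fy.
  by split; [have := fF x|have := fF y]; rewrite /F eqxx // eq_sym (negPf xy).
rewrite card_family foldrE big_image /= (bigD1 x) //= (bigD1 y) 1?eq_sym //=.
rewrite {1 2}/F eqxx eq_sym (negPf xy) eqxx !card1 !mul1n.
rewrite (eq_bigr (fun=> #|C|)) => [|z /andP[zx zy]]; last first.
  by rewrite /F (negPf zx) (negPf zy).
rewrite prod_nat_const -expnD; congr (_ ^ _).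
have := cardC [pred z | (z == x) || (z == y)].
rewrite (_ : #|[pred z | (z == x) || (z == y)]| = 2); last first.
  by rewrite (eq_card (B := pred2 x y)) ?card2 ?xy.
rewrite addnC => <-; congr (_ + _); apply: eq_card => z.
by rewrite !inE /= negb_or.
Qed.

Lemma card_ffun_collision (X C : finType) (x y : X) : x != y ->
  #|[set f : {ffun X -> C} | f x == f y]| * #|C| = #|C| ^ #|X|.
Proof.
move=> xy; case: (posnP #|C|) => [C0|C_gt0].
  by rewrite C0 muln0 exp0n //; apply/card_gt0P; exists x.
(* The extra factor [#|C|] allows [card_ffun_fix2] to be applied once for each common value [c]. *)
apply/eqP; rewrite -(eqn_pmul2r C_gt0) -mulnA; apply/eqP.
have -> : #|[set f : {ffun X -> C} | f x == f y]| =
    \sum_c #|[set f : {ffun X -> C} | (f x == c) && (f y == c)]|.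
  rewrite -sum1_card (partition_big (fun f : {ffun X -> C} => f x) predT) //=.
  apply: eq_bigr => c _; rewrite -sum1_card; apply: eq_bigl => f.
  by rewrite !inE; case: (f x =P c) => [->|]; rewrite ?andbT ?andbF // eq_sym.
rewrite mulnn big_distrl /= (eq_bigr (fun=> #|C| ^ #|X|)); last first.
  by move=> c _; rewrite card_ffun_fix2.
by rewrite sum_nat_const mulnC.
Qed.

(** * Hitting sets and separating colourings *)

(** Greedy choice: each new vertex misses at most the average number of the sets not yet hit, which
    is at most a fraction [(n - T) / n] of them. *)
Lemma hitting_set (I : finType) n (n_gt0 : 0 < n) (A : {set I})
    (H : I -> {set 'I_n}) T r : (forall i, i \in A -> T <= #|H i|) ->
  exists R : {set 'I_n}, #|R| <= r /\
    #|[set i in A | [disjoint H i & R]]| * n ^ r <= #|A| * (n - T) ^ r.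
Proof.
move=> A_big; elim: r => [|r [R [R_le IH]]].
  exists set0; rewrite cards0 !expn0 !muln1; split=> //.
  by apply/subset_leq_card/subsetP => i; rewrite inE => /andP[].
set B := [set i in A | _] in IH.
have [x] := leq_average (Ordinal n_gt0) (fun x => #|[set i in B | x \in ~: H i]|).
rewrite -(sum_card_exchange (mem B) (fun i => mem (~: H i))) card_ord => x_le.
exists (x |: R); split.
  by rewrite cardsU1 (leq_add (leq_b1 _) R_le).
have -> : [set i in A | [disjoint H i & x |: R]] = [set i in B | x \in ~: H i].
  apply/setP => i; rewrite !inE -!setI_eq0 setIUr setU_eq0 !setI_eq0.
  by rewrite disjoint_sym disjoints1 -andbA [(_ \notin _) && _]andbC.
rewrite !expnS mulnA [_ * n]mulnC.
apply: leq_trans (leq_mul x_le (leqnn _)) _.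
apply: (@leq_trans (#|B| * (n - T) * n ^ r)).
  rewrite leq_mul2r -sum_nat_const; apply/orP; right; apply: leq_sum => i.
  rewrite inE => /andP[/A_big Hi _]; rewrite -[#|_|]/#|~: H i|.
  by rewrite cardsCs setCK card_ord leq_sub2l.
by rewrite [_ * (n - T)]mulnC -mulnA [X in _ <= X]mulnCA leq_mul2l IH orbT.
Qed.

(** Union bound: a uniform colouring merges two given distinct points with probability [1 / k.+1],
    and [H i] has at most [T ^ 2] pairs. Some colouring is no worse than the average. *)
Lemma separating_coloring (I : finType) n k (A : {set I})
    (H : I -> {set 'I_n}) T : (forall i, i \in A -> #|H i| <= T) ->
  exists f : {ffun 'I_n -> 'I_k.+1},
    #|[set i in A | ~~ [forall x in H i, forall y in H i, (f x == f y) ==> (x == y)]]|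
      * k.+1 <= #|A| * T ^ 2.
Proof.
move=> A_small.
pose bad (f : {ffun 'I_n -> 'I_k.+1}) :=
  [set i in A | ~~ [forall x in H i, forall y in H i, (f x == f y) ==> (x == y)]].
have [f] := leq_average [ffun=> ord0] (fun f => #|bad f|).
rewrite card_ffun !card_ord => f_le; exists f; rewrite -/(bad f).
have k_gt0 : 0 < k.+1 ^ n by rewrite expn_gt0.
rewrite -(leq_pmul2l k_gt0) mulnA.
apply: leq_trans (leq_mul f_le (leqnn _)) _.
pose col i := [set g : {ffun 'I_n -> 'I_k.+1} | 
  [exists p in setX (H i) (H i), (p.1 != p.2) && (g p.1 == g p.2)]].
have -> : \sum_g #|bad g| = \sum_(i in A) #|col i|.
  rewrite (sum_card_exchange (mem A) (fun i => mem (col i))).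
  apply: eq_bigr => g _; apply: eq_card => i; rewrite !inE; congr (_ && _).
  apply/forall_inPn/exists_inP => [[x Hx /forall_inPn[y Hy]]|[[x y]]].
    by rewrite negb_imply => xy; exists (x, y); rewrite ?inE ?Hx //= andbC.
  rewrite inE /= => /andP[Hx Hy] xy; exists x => //; apply/forall_inPn; exists y => //.
  by rewrite negb_imply andbC.
rewrite big_distrl /= mulnA [_ * #|A|]mulnC -mulnA -sum_nat_const.
apply: leq_sum => i /A_small Hi.
apply: (@leq_trans (\sum_(p in setX (H i) (H i)) k.+1 ^ n)); last first.
  by rewrite sum_nat_const cardsX mulnn mulnC leq_mul2l leq_exp2r // Hi orbT.
pose Q p := [set g : {ffun 'I_n -> 'I_k.+1} | (p.1 != p.2) && (g p.1 == g p.2)].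
apply: (@leq_trans ((\sum_(p in setX (H i) (H i)) #|Q p|) * k.+1)).
  rewrite leq_mul2r; apply/orP; right.
  rewrite -[#|_|]/(#|col i|).
  have -> : col i = \bigcup_(p in setX (H i) (H i)) Q p.
    apply/setP => g; rewrite inE; apply/exists_inP/bigcupP => -[p Hp Qp];
      exists p => //; by rewrite inE in Qp *.
  apply: (big_ind2 (fun (X : {set _}) m => #|X| <= m)) => //.
    by rewrite cards0.
  by move=> X a Y b Xa Yb; rewrite (leq_trans (leq_card_setU X Y)) // leq_add.
rewrite big_distrl /=; apply: leq_sum => -[x y] _; rewrite /Q /=.
case: (boolP (x != y)) => /= xy.
  by have := card_ffun_collision 'I_k.+1 xy; rewrite !card_ord => <-.
by rewrite (_ : [set _ | _] = set0) ?cards0 //; apply/setP => g; rewrite !inE.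
Qed.

(** * Matchings of ordered pairs and Ruzsa-Szemerédi graphs *)

(** The coordinates are the two sides of a bipartite graph: even for [X = Y], a vertex may come
    first in one pair and second in another. *)
Definition bimatching (X Y : finType) (M : {set X * Y}) :=
  [forall p in M, forall q in M, (p.1 == q.1) || (p.2 == q.2) ==> (p == q)].

Lemma bimatchingP (X Y : finType) (M : {set X * Y}) :
  reflect {in M &, forall p q, p.1 = q.1 \/ p.2 = q.2 -> p = q} (bimatching M).
Proof.
apply: (iffP forall_inP) => [mM p q Mp Mq pq|mM p Mp].
  have /forall_inP/(_ q Mq)/implyP := mM p Mp; case: pq => ->; rewrite eqxx ?orbT;
  by move=> /(_ isT)/eqP.
by apply/forall_inP => q Mq; apply/implyP => /orP[]/eqP pq; apply/eqP/mM; auto.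
Qed.

(** A sigma type, so that a matching can later be picked as a function of its parameters. *)
Lemma maximal_bimatching (X Y : finType) (E : {set X * Y}) :
  {M : {set X * Y} | bimatching M && (M \subset E) &
    forall p, p \in E -> exists2 q, q \in M & p.1 = q.1 \/ p.2 = q.2}.
Proof.
have [|M /maxsetP[PM maxM]] :=
  @ex_maxset _ [pred M : {set X * Y} | bimatching M && (M \subset E)].
  by exists set0; rewrite /= sub0set andbT; apply/forall_inP => p; rewrite inE.
exists M => // p Ep.
case: (boolP [exists q in M, (p.1 == q.1) || (p.2 == q.2)]).
  by case/exists_inP => q Mq /orP[]/eqP pq; exists q; auto.
rewrite negb_exists_in => /forall_inP pM.
have /andP[/bimatchingP mM sM] := PM.
have npM q : q \in M -> p.1 = q.1 \/ p.2 = q.2 -> False.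
  by move=> /pM; rewrite negb_or => /andP[/eqP? /eqP?] [].
suff pMe : p |: M = M by exists p; [rewrite -pMe setU11 | left].
apply: maxM; last exact: subsetUr.
rewrite /= subUset sub1set Ep sM !andbT.
apply/bimatchingP => q r; rewrite !in_setU1.
case/predU1P => [->|Mq]; case/predU1P => [->|Mr] //.
- by move=> h; case: (npM r).
- by move=> h; case: (npM q) => //; case: h; auto.
- exact: mM.
Qed.

Lemma bimatchingS (X Y : finType) (M N : {set X * Y}) :
  N \subset M -> bimatching M -> bimatching N.
Proof.
move=> /subsetP NM /bimatchingP mM; apply/bimatchingP => p q Np Nq.
by apply: mM; apply: NM.
Qed.

(** The last hypothesis makes each matching induced: an edge across two pairs of [M k] can only come
    from [M k]. The side [L] excludes edges within a side and lets pairs be read as unordered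
    edges. *)
Lemma RS_graph_of_matchings n (L : {set 'I_n}) (M : 'I_n -> {set 'I_n * 'I_n}) :
  (forall k, bimatching (M k)) ->
  (forall k p, p \in M k -> (p.1 \in L) && (p.2 \notin L)) ->
  (forall k l p q, p \in M k -> q \in M k -> (p.1, q.2) \in M l -> k = l) ->
  \sum_k #|M k| <= max_RS_edges n.
Proof.
case: n L M => [|n] L M mM ML crossM; first by rewrite big_ord0.
have LM k x y : (x, y) \in M k -> (x \in L) * (y \in L = false).
  by move/ML => /= /andP[-> /negPf].
(* The crossing condition with [p = q] makes the matchings disjoint, so the colour of an edge is
   well defined. *)
have uniqM k l p : p \in M k -> p \in M l -> k = l.
  by move=> pk pl; apply: (crossM _ _ p p) => //; rewrite -surjective_pairing.
pose inM k x y := ((x, y) \in M k) || ((y, x) \in M k).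
have inMC k x y : inM k x y = inM k y x by rewrite /inM orbC.
have inM_uniq k l x y : inM k x y -> inM l x y -> k = l.
  by case/orP=> h1 /orP[] h2; apply: (uniqM _ _ _ h1) => //;
    have := LM _ _ _ h1; rewrite !(LM _ _ _ h2) => -[].
pose g := [ffun p : 'I_n.+1 * 'I_n.+1 => [exists k, inM k p.1 p.2]].
pose f := [ffun p : 'I_n.+1 * 'I_n.+1 => odflt ord0 [pick k | inM k p.1 p.2]].
(* The default colour [ord0] is used only on non-edges, which [g] masks. *)
have gE k x y : g (x, y) && (f (x, y) == k) = inM k x y.
  rewrite !ffunE /=; case: pickP => [l lxy|no] /=.
    have -> /= : [exists k, inM k x y] by apply/existsP; exists l.
    by apply/eqP/idP => [<- //|]; apply: inM_uniq.
  by rewrite no; apply/negbTE; rewrite negb_and; apply/orP; left;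
     apply/existsPn => l; rewrite no.
have RSg : is_RS_graph g.
  apply/andP; split.
    apply/andP; split.
      apply/forallP => x; rewrite ffunE /=; apply/existsPn => k; rewrite /inM orbb.
      by apply/negP => /LM[->].
    apply/forallP => x; apply/forallP => y; rewrite !ffunE /=; apply/eqP.
    by apply: eq_existsb => k; apply: inMC.
  apply/existsP; exists f; apply/andP; split.
    apply/forallP => x; apply/forallP => y; rewrite !ffunE /=; apply/eqP.
    by congr odflt; apply: eq_pick => k; apply: inMC.
  apply/forallP => k; apply/andP; split.
    apply/forallP => x; apply/forallP => y; apply/forallP => z.
    apply/implyP => /and4P[g1 g2 f1 f2].
    have : inM k x y by rewrite -gE g1.
    have : inM k x z by rewrite -gE g2.
    have /bimatchingP mMk := mM k.
    case/orP=> h1 /orP[] h2.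
    - by have [] := mMk _ _ h1 h2 (or_introl erefl) => ->.
    - by have := LM _ _ _ h1; rewrite !(LM _ _ _ h2) => -[].
    - by have := LM _ _ _ h1; rewrite !(LM _ _ _ h2) => -[].
    - by have [] := mMk _ _ h1 h2 (or_intror erefl) => ->.
  apply/existsP; exists [set x | [exists y, inM k x y]].
  apply/forallP => x; apply/forallP => y; rewrite gE !inE; apply/eqP.
  apply/idP/and3P => [kxy|[/existsP[x' kx] /existsP[y' ky]]].
    split; [by apply/existsP; exists y|by apply/existsP; exists x; rewrite inMC|].
    by move: kxy; rewrite -gE => /andP[].
  (* Since [z] is in [L] and [t] is not, their partners give pairs [(z, z')] and [(t', t)] of [M k],
     and [(z, t)] is the crossing pair. Both orientations of the edge reduce to this. *)
  rewrite ffunE /= => /existsP[l]; suff main z t z' t' :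
      inM k z z' -> inM k t t' -> (z, t) \in M l -> (z, t) \in M k.
    by case/orP => h; rewrite /inM; [rewrite (main x y x' y')|rewrite (main y x y' x') ?orbT].
  move=> kz kt h; have [zL tL] := LM _ _ _ h.
  case/orP: kz => [kz|/LM]; last by rewrite zL => -[].
  case/orP: kt => [/LM|kt]; first by rewrite tL => -[].
  by rewrite (crossM _ _ _ _ kz kt h).
apply: leq_trans (leq_bigmax_cond _ RSg).
(* [num_edges] counts each edge with its smaller end first. Orienting pairs this way loses none, as
   no pair of [U] has its reverse in [U]. *)
pose h (p : 'I_n.+1 * 'I_n.+1) := if p.1 < p.2 then p else (p.2, p.1).
pose U := \bigcup_k M k.
have hU : {in U &, injective h}.
  move=> [x y] [x' y'] /bigcupP[k _ /LM[xL yL]] /bigcupP[l _ /LM[xL' yL']].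
  rewrite /h /=; case: ltnP => _; case: ltnP => _ // [] e1 e2.
  - by rewrite e2 xL' in yL.
  - by rewrite e1 xL' in yL.
  - by rewrite e1 e2.
have -> : \sum_k #|M k| = #|U|.
  rewrite -[RHS]sum1_card.
  rewrite (partition_big (fun p => odflt ord0 [pick k | p \in M k]) predT) //=.
  apply: eq_bigr => k _; rewrite -sum1_card; apply: eq_bigl => p.
  apply/idP/andP => [pk|[/bigcupP[l _ pl] /eqP]].
    split; first by apply/bigcupP; exists k.
    by case: pickP => [l pl|/(_ k)]; [rewrite (uniqM _ _ _ pk pl)|rewrite pk].
  by case: pickP => [i pi|/(_ l)]; [move=> /= <-|rewrite pl].
rewrite -(card_in_imset hU) subset_leq_card //.
apply/subsetP => _ /imsetP[[x y] /bigcupP[k _ kxy] ->]; rewrite /h inE /=.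
have [xL yL] := LM _ _ _ kxy.
have gxy : [exists k, inM k x y] by apply/existsP; exists k; rewrite /inM kxy.
case: (ltngtP x y) => [xy|yx|/val_inj xy] /=; rewrite ?ffunE /=.
- by rewrite xy.
- by rewrite yx; apply/existsP; exists k; rewrite /inM kxy orbT.
- by rewrite xy yL in xL.
Qed.

(* A random bipartition keeps each ordered pair with probability 1/4. *)
Lemma cross_matchings_card n (M : 'I_n -> {set 'I_n * 'I_n}) :
  (forall k, bimatching (M k)) ->
  (forall k p, p \in M k -> p.1 != p.2) ->
  (forall k l p q, p \in M k -> q \in M k -> (p.1, q.2) \in M l -> k = l) ->
  \sum_k #|M k| <= 4 * max_RS_edges n.
Proof.
move=> mM neM crossM.
pose P (g : {ffun 'I_n -> bool}) (p : 'I_n * 'I_n) := g p.1 && ~~ g p.2.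
pose N g k := [set p in M k | P g p].
have [g] := geq_average [ffun=> true] (fun g => \sum_k #|N g k|).
rewrite card_ffun card_bool card_ord => leg.
have Ng : \sum_k #|N g k| <= max_RS_edges n.
  apply: (@RS_graph_of_matchings n [set x | g x]).
  - by move=> k; apply: bimatchingS (mM k); apply/subsetP => p; rewrite inE => /andP[].
  - by move=> k p; rewrite !inE => /andP[].
  by move=> k l p q; rewrite !inE => /andP[pk _] /andP[qk _] /andP[pq _]; apply: crossM pk qk pq.
rewrite -(leq_pmul2l (expn_gt0 2 n)).
apply: (@leq_trans (4 * (2 ^ n * \sum_k #|N g k|))); last first.
  by rewrite mulnCA leq_mul2l leq_mul2l Ng !orbT.
apply: leq_trans (leq_mul (leqnn 4) leg).
rewrite exchange_big !big_distrr /=; apply: leq_sum => k _.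
have -> : \sum_h #|N h k| = \sum_(p in M k) #|[set h | P h p]|.
  rewrite (sum_card_exchange (mem (M k)) (fun p => mem [set h | P h p])).
  by apply: eq_bigr => h _; apply: eq_card => p; rewrite !inE.
rewrite mulnC -sum_nat_const big_distrr; apply: leq_sum => p /neM pp /=.
have := @card_ffun_fix2 _ bool _ _ true false pp.
rewrite card_bool card_ord => <-; rewrite mulnC leq_mul2l; apply/orP; right.
by apply/subset_leq_card/subsetP => h; rewrite !inE /P => /andP[/eqP-> /eqP->].
Qed.

(** * Distances and geodesic hulls *)

Lemma walk_weight_cat n (w : 'I_n -> 'I_n -> nat) u p q :
  walk_weight w u (p ++ q) = walk_weight w u p + walk_weight w (last u p) q.
Proof. by rewrite /walk_weight pairmap_cat sumn_cat. Qed.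

Lemma is_dist_exists n (e : rel 'I_n) (w : 'I_n -> 'I_n -> nat) u v :
  connect e u v -> exists d, is_dist e w u v d.
Proof.
case/connectP=> p pp lp.
have: exists q, is_walk e u v q /\ walk_weight w u q = walk_weight w u p by exists p.
elim/ltn_ind: (walk_weight w u p) => d IH ex_d.
have [[q [walk_q lt_q]]|no_lt] :=
  classic (exists q, is_walk e u v q /\ walk_weight w u q < d).
  by apply: (IH _ lt_q); exists q.
exists d; split=> // q walk_q; rewrite leqNgt; apply/negP => lt_q; apply: no_lt.
by exists q.
Qed.

(** The value is meaningful only for connected pairs; hence the connectivity tests in
    [geodesic_hull]. *)
Definition dist n (e : rel 'I_n) (w : 'I_n -> 'I_n -> nat) (u v : 'I_n) : nat :=
  epsilon (inhabits 0) (is_dist e w u v).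

Lemma distP n (e : rel 'I_n) (w : 'I_n -> 'I_n -> nat) u v :
  connect e u v -> is_dist e w u v (dist e w u v).
Proof. by move=> /(is_dist_exists w); apply: epsilon_spec. Qed.

Lemma connect_walk n (e : rel 'I_n) u v p : is_walk e u v p -> connect e u v.
Proof. by case=> pp lp; apply/connectP; exists p. Qed.

Lemma dist_le_walk n (e : rel 'I_n) (w : 'I_n -> 'I_n -> nat) u v p :
  is_walk e u v p -> dist e w u v <= walk_weight w u p.
Proof. by move=> walk_p; have [_] := distP w (connect_walk walk_p); apply. Qed.

Lemma dist_triangle n (e : rel 'I_n) (w : 'I_n -> 'I_n -> nat) u x v :
  connect e u x -> connect e x v -> dist e w u v <= dist e w u x + dist e w x v.
Proof.
move=> /(distP w)[[p [[pp lp] <-]] _] /(distP w)[[q [[pq lq] <-]] _].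
rewrite -[in X in _ + X]lp -walk_weight_cat; apply: dist_le_walk.
by split; rewrite ?cat_path ?last_cat ?lp // pp.
Qed.

Lemma distxx n (e : rel 'I_n) (w : 'I_n -> 'I_n -> nat) u : dist e w u u = 0.
Proof. by apply/eqP; rewrite -leqn0; apply: (@dist_le_walk _ _ _ _ _ [::]). Qed.

Definition geodesic_hull n (e : rel 'I_n) (w : 'I_n -> 'I_n -> nat) (u v : 'I_n) :=
  [set x | [&& connect e u x, connect e x v
             & dist e w u x + dist e w x v == dist e w u v]].

(** Cutting a lightest walk at one of its vertices leaves two walks at least as heavy as the two
    distances, so the triangle inequality is tight there. *)
Lemma shortest_walk n (e : rel 'I_n) (w : 'I_n -> 'I_n -> nat) u v :
  connect e u v ->
  exists p, is_walk e u v p /\ {subset u :: p <= geodesic_hull e w u v}.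
Proof.
move=> cuv; have [[p [walk_p wp]] _] := distP w cuv; exists p; split=> // x.
case: walk_p wp => + + + xp; case/splitPl: xp => p1 p2 lx.
rewrite cat_path last_cat lx => /andP[pp1 pp2] lv.
rewrite walk_weight_cat lx => wp.
have walk1 : is_walk e u x p1 by [].
have walk2 : is_walk e x v p2 by [].
have [c1 c2] := (connect_walk walk1, connect_walk walk2).
rewrite inE c1 c2 eqn_leq dist_triangle // -wp leq_add //; exact: dist_le_walk.
Qed.

(** With weights at most 1, the distance from [u] rises by at most 1 per step of a shortest walk, so
    it takes every value up to [dist e w u v], at distinct vertices of the hull. *)
Lemma dist_lt_card_hull n (e : rel 'I_n) (w : 'I_n -> 'I_n -> nat) u v :
  (forall x y, e x y -> w x y <= 1) -> connect e u v ->
  dist e w u v < #|geodesic_hull e w u v|.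
Proof.
move=> w1 cuv; have [p [[pp lp] pH]] := shortest_walk w cuv.
have step a : a <= dist e w u v -> exists2 x, x \in u :: p & dist e w u x = a.
  have {pH} walk_step q x : path e x q -> a <= dist e w u (last x q) ->
      dist e w u x <= a -> connect e u x -> exists2 y, y \in x :: q & dist e w u y = a.
    elim: q x => [|y q IH] x /= => [_ le_a le_x _|].
      by exists x; rewrite ?mem_head //; apply/eqP; rewrite eqn_leq le_x.
    case/andP=> exy pq le_a; rewrite leq_eqVlt => /orP[/eqP xa _|lt_x cux].
      by exists x; rewrite ?mem_head.
    have walk_xy : is_walk e x y [:: y] by split; rewrite //= exy.
    have cxy := connect_walk walk_xy.
    have [|z zq za] := IH y pq le_a _ (connect_trans cux cxy); last first.
      by exists z; rewrite // inE zq orbT.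
    apply: leq_trans (dist_triangle w cux cxy) _.
    rewrite (leq_trans _ lt_x) // -addn1 leq_add2l.
    by rewrite (leq_trans (dist_le_walk w walk_xy)) // /walk_weight /= addn0 w1.
  by rewrite -lp => le_a; apply: walk_step; rewrite ?distxx.
have sub : {subset iota 0 (dist e w u v).+1 <=
              map (dist e w u) (enum (geodesic_hull e w u v))}.
  move=> a; rewrite mem_iota add0n ltnS => /step[x /pH xH <-].
  by apply: map_f; rewrite mem_enum.
have := uniq_leq_size (iota_uniq 0 _) sub.
by rewrite size_iota size_map -cardE.
Qed.

(** * Covers of geodesic hulls and the hub labeling *)

Lemma sum_card_fibers (X Y : finType) (B : {set X * Y}) :
  \sum_x #|[set y | (x, y) \in B]| = #|B|.
Proof.
rewrite -[RHS]sum1_card (eq_bigl (fun p => (p.1, p.2) \in B)); last by case.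
rewrite -(pair_big_dep predT (fun x y => (x, y) \in B) (fun _ _ => 1)) /=.
by apply: eq_bigr => x _; rewrite -sum1_card; apply: eq_bigl => y; rewrite inE.
Qed.

Lemma leq_card_bigcup (I X : finType) (A : {set I}) (B : I -> {set X}) m :
  (forall i, i \in A -> #|B i| <= m) -> #|\bigcup_(i in A) B i| <= #|A| * m.
Proof.
move=> Bm; rewrite -sum_nat_const.
apply: (@leq_trans (\sum_(i in A) #|B i|)); last exact: leq_sum.
apply: (big_ind2 (fun (Z : {set X}) c => #|Z| <= c)); rewrite ?cards0 //.
by move=> Z a Y b Za Yb; rewrite (leq_trans (leq_card_setU Z Y)) // leq_add.
Qed.

(** In the bound, [T ^ 2] counts the distance pairs, [k] the colours, and 8 is 2 endpoints per
    matched pair times the factor 4 of [cross_matchings_card]. *)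
Lemma geodesic_cover n (e : rel 'I_n) (w : 'I_n -> 'I_n -> nat) T k
    (f : 'I_n -> 'I_k) :
  (forall x y, e x y -> w x y <= 1) ->
  exists F : 'I_n -> {set 'I_n},
    \sum_u #|F u| <= 8 * k * T ^ 2 * max_RS_edges n /\
    forall u v, connect e u v -> u != v -> #|geodesic_hull e w u v| < T ->
      {in geodesic_hull e w u v &, injective f} ->
      forall x, x \in geodesic_hull e w u v -> x \in F u \/ x \in F v.
Proof.
move=> w1.
pose H := geodesic_hull e w.
pose inj p := [forall x in H p.1 p.2, forall y in H p.1 p.2, (f x == f y) ==> (x == y)].
pose E (c : 'I_T * 'I_T) x := [set p : 'I_n * 'I_n |
  [&& p.1 != p.2, inj p, x \in H p.1 p.2, dist e w p.1 x == c.1 & dist e w x p.2 == c.2]].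
pose M c x := s2val (maximal_bimatching (E c x)).
have mM c x : bimatching (M c x) by have /andP[] := s2valP (maximal_bimatching (E c x)).
have ME c x p : p \in M c x -> p \in E c x.
  by have /andP[_ /subsetP] := s2valP (maximal_bimatching (E c x)); apply.
have maxM c x : forall p, p \in E c x -> exists2 q, q \in M c x & p.1 = q.1 \/ p.2 = q.2.
  exact: s2valP' (maximal_bimatching (E c x)).
have color_sum c h : \sum_(x | f x == h) #|M c x| <= 4 * max_RS_edges n.
  (* Other colours get an empty matching, so that the family is indexed by all of ['I_n]. *)
  pose Mh x := if f x == h then M c x else set0.
  have -> : \sum_(x | f x == h) #|M c x| = \sum_x #|Mh x|.
    by rewrite big_mkcond; apply: eq_bigr => x _; rewrite /Mh; case: eqP; rewrite ?cards0.
  have inMh x p : p \in Mh x -> f x = h /\ p \in E c x.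
    by rewrite /Mh; case: eqP => [fx /ME|]; rewrite ?inE.
  apply: cross_matchings_card => [x|x p|x y p q].
  - rewrite /Mh; case: eqP => // _; apply: bimatchingS (mM c x); exact: sub0set.
  - by move=> /inMh[_]; rewrite inE => /andP[].
  move=> /inMh[fx px] /inMh[_ qx] /inMh[fy].
  move: px; rewrite !inE => /and5P[_ _ /and3P[cpx _ _] /eqP dpx _].
  move: qx; rewrite !inE => /and5P[_ _ /and3P[_ cxq _] _ /eqP dxq].
  case/and5P=> /= _ injpq /and3P[cpy cyq /eqP dpq] /eqP dpy /eqP dyq.
  (* The crossing pair lies in [E c y], so its distance is [c.1 + c.2]; its ends are at distances
     [c.1] and [c.2] from [x]. Thus [x] and [y] share a hull on which [f] is injective, and they
     have the same colour. *)
  have xH : x \in H p.1 q.2 by rewrite inE cpx cxq dpx dxq -dpq dpy dyq /=.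
  have yH : y \in H p.1 q.2 by rewrite inE cpy cyq dpq /=.
  have /forall_inP/(_ y yH) := forall_inP injpq x xH.
  by rewrite fx fy eqxx => /eqP.
pose F u := [set x | [exists c, [exists p in M c x, (p.1 == u) || (p.2 == u)]]].
exists F; split; last first.
  move=> u v cuv uv uvT finj x xH.
  have := xH; rewrite inE => /and3P[_ _ /eqP duv].
  (* A hull below [T] keeps both distances below [T], so they form an index in ['I_T * 'I_T]. *)
  have lt_d := leq_trans (dist_lt_card_hull w1 cuv) (ltnW uvT).
  have lta : dist e w u x < T by apply: leq_ltn_trans lt_d; rewrite -duv leq_addr.
  have ltb : dist e w x v < T by apply: leq_ltn_trans lt_d; rewrite -duv leq_addl.
  (* By maximality [(u, v)] shares a coordinate with a matched pair, so [x] is given to [u] or to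
     [v]. *)
  have [|q qM] := @maxM (Ordinal lta, Ordinal ltb) x (u, v).
    rewrite inE /= uv -/(H u v) xH !eqxx !andbT /=.
    apply/forall_inP => y yH; apply/forall_inP => z zH; apply/implyP => /eqP fyz.
    by apply/eqP/finj.
  move=> /= [] ->; [left|right]; rewrite inE; apply/existsP;
    exists (Ordinal lta, Ordinal ltb); apply/exists_inP; exists q; rewrite ?eqxx ?orbT //.
have F_le u : #|F u| <=
    \sum_x \sum_c \sum_(p in M c x) ((p.1 == u) + (p.2 == u)).
  rewrite -sum1_card big_mkcond; apply: leq_sum => x _.
  rewrite inE; case: ifP => // /existsP[c /exists_inP[p pM pu]].
  rewrite (bigD1 c) //= (bigD1 p) //=.
  by case: (p.1 == u) pu => //= ->.
apply: (@leq_trans (\sum_u \sum_x \sum_c \sum_(p in M c x) ((p.1 == u) + (p.2 == u)))).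
  by apply: leq_sum => u _; apply: F_le.
have -> : \sum_u \sum_x \sum_c \sum_(p in M c x) ((p.1 == u) + (p.2 == u)) =
    2 * \sum_c \sum_x #|M c x|.
  have sum1 (y : 'I_n) : \sum_u (y == u) = 1.
    by rewrite (bigD1 y) //= eqxx big1 // => u; rewrite eq_sym => /negPf->.
  rewrite exchange_big [in RHS]exchange_big big_distrr; apply: eq_bigr => x _ /=.
  rewrite exchange_big big_distrr; apply: eq_bigr => c _ /=.
  rewrite exchange_big mulnC -sum_nat_const; apply: eq_bigr => p _.
  by rewrite big_split /= !sum1.
have c_le c : \sum_x #|M c x| <= k * (4 * max_RS_edges n).
  rewrite (partition_big f predT) //= -[X in X * _]card_ord -sum_nat_const.
  by apply: leq_sum => h _; apply: color_sum.
apply: (@leq_trans (2 * (T ^ 2 * (k * (4 * max_RS_edges n))))); last by nia.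
rewrite leq_mul2l /=; apply: (@leq_trans (\sum_(c : 'I_T * 'I_T) k * (4 * max_RS_edges n))).
  by apply: leq_sum => c _; apply: c_le.
by rewrite sum_nat_const card_prod card_ord mulnn.
Qed.

(** [b1] and [b2] count the exceptional pairs with large and small hulls; as separate witnesses they
    have bounds free of division. The factor [D.+1] is the size of a closed neighbourhood. *)
Lemma hub_labeling_of_parameters n (e : rel 'I_n) (w : 'I_n -> 'I_n -> nat) D T k r :
  0 < n -> 0 < k -> (forall x y, e x y -> w x y <= 1) -> max_degree_le e D ->
  exists S b1 b2, [/\ hub_labeling e w S,
    total_size S <= n + n * r + b1 + b2 + (8 * k * T ^ 2 * max_RS_edges n) * D.+1,
    b1 * n ^ r <= n ^ 2 * (n - T) ^ r & b2 * k <= n ^ 2 * T ^ 2].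
Proof.
case: k => // k n_gt0 _ w1 degD.
pose H (p : 'I_n * 'I_n) := geodesic_hull e w p.1 p.2.
pose A1 := [set p : 'I_n * 'I_n | T <= #|H p|].
pose A2 := [set p : 'I_n * 'I_n | #|H p| < T].
have A_le (A : {set 'I_n * 'I_n}) : #|A| <= n ^ 2.
  by rewrite (leq_trans (max_card _)) // card_prod card_ord mulnn.
have [|R [R_le B1_le]] := @hitting_set _ n n_gt0 A1 H T r.
  by move=> p; rewrite inE.
have [|f B2_le] := @separating_coloring _ n k A2 H T.
  by move=> p; rewrite inE => /ltnW.
set B1 := [set p in A1 | _] in B1_le; set B2 := [set p in A2 | _] in B2_le.
have [F [F_le F_cover]] := @geodesic_cover n e w T k.+1 f w1.
pose N x := x |: [set y | e x y].
pose NF u := \bigcup_(x in F u) N x.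
pose S u := u |: (R :|: [set v | (u, v) \in B1] :|: [set v | (u, v) \in B2] :|: NF u).
have SP u z : [|| z == u, z \in R, (u, z) \in B1, (u, z) \in B2 | z \in NF u] -> z \in S u.
  by rewrite !inE -!orbA.
exists S, #|B1|, #|B2|; split; last first.
- by rewrite (leq_trans B2_le) // leq_mul2r A_le orbT.
- by rewrite (leq_trans B1_le) // leq_mul2r A_le orbT.
- have S_le u : #|S u| <=
      1 + r + #|[set v | (u, v) \in B1]| + #|[set v | (u, v) \in B2]| + #|F u| * D.+1.
    rewrite cardsU1 -!addnA leq_add ?leq_b1 // !addnA.
    apply: (leq_trans (leq_card_setU _ _)); apply: leq_add; last first.
      by apply: leq_card_bigcup => x _; rewrite cardsU1 -add1n leq_add ?leq_b1.
    do 2![apply: (leq_trans (leq_card_setU _ _)); apply: leq_add => //].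
  apply: (@leq_trans (\sum_u (1 + r + #|[set v | (u, v) \in B1]| +
      #|[set v | (u, v) \in B2]| + #|F u| * D.+1))); first by apply: leq_sum.
  rewrite !big_split /= !sum_card_fibers -big_distrl /= !sum_nat_const card_ord muln1.
  by rewrite leq_add2l leq_mul2r F_le orbT.
move=> u v cuv.
have via z : z \in S u -> z \in S v -> z \in H (u, v) ->
    exists z, [/\ z \in S u, z \in S v &
      exists a b d, [/\ is_dist e w u z a, is_dist e w z v b, is_dist e w u v d
                      & a + b = d]].
  move=> zu zv; rewrite inE => /and3P[cuz czv /eqP duv]; exists z; split=> //.
  by exists (dist e w u z), (dist e w z v), (dist e w u v); split=> //; apply: distP.
have uH : u \in H (u, v) by rewrite inE connect0 cuv distxx /=.
have vH : v \in H (u, v) by rewrite inE connect0 cuv distxx addn0 /=.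
have [uv|uv] := eqVneq u v.
  by apply: (via u) => //; apply: SP; rewrite ?uv eqxx.
have [leT|ltT] := leqP T #|H (u, v)|.
  case: (boolP [disjoint H (u, v) & R]) => [dis|].
    by apply: (via v) => //; apply: SP; rewrite ?eqxx // !inE leT dis !orbT.
  rewrite -setI_eq0 => /set0Pn[z /setIP[zH zR]].
  by apply: (via z) => //; apply: SP; rewrite zR orbT.
case: (boolP ((u, v) \in B2)) => [uvB2|].
  by apply: (via v) => //; apply: SP; rewrite ?eqxx // uvB2 !orbT.
rewrite inE inE ltT negbK => /forall_inP f_inj.
have {}f_inj : {in H (u, v) &, injective f}.
  by move=> x y xH yH fxy; have /forall_inP/(_ y yH) := f_inj x xH; rewrite fxy eqxx => /eqP.
have {F_cover} F_cover := F_cover u v cuv uv ltT f_inj.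
have NFP x y z : y \in F x -> (z == y) || e y z -> z \in S x.
  move=> yF yz; apply: SP; have -> : z \in NF x; last by rewrite !orbT.
  by apply/bigcupP; exists y; rewrite // !inE.
have [uF|uF] := F_cover u uH; last first.
  by apply: (via u) => //; [apply: SP|apply: (NFP _ u)]; rewrite ?eqxx.
have [p [[pp lp] pH]] := shortest_walk w cuv.
(* The walk is followed while its vertices are given to [u]. The first vertex not given to [u] is
   given to [v] and is adjacent to one given to [u]; if there is none, [v] itself is the hub. *)
suff walk_hub q x : path e x q -> last x q = v -> {subset x :: q <= H (u, v)} ->
    x \in F u -> exists z, [/\ z \in S u, z \in S v & z \in H (u, v)].
  by have [z [zu zv zH]] := walk_hub p u pp lp pH uF; apply: (via z).
elim: q x => [|y q IH] x /= => [_ -> xH xF|/andP[exy pq] lq qH xF].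
  by exists v; split; rewrite ?vH //; [apply: (NFP _ v)|apply: SP]; rewrite ?eqxx.
have yqH : {subset y :: q <= H (u, v)} by move=> z zq; apply: qH; rewrite inE zq orbT.
have yH := yqH y (mem_head y q).
have [yF|yF] := F_cover y yH; first exact: (IH y).
by exists y; split=> //; [apply: (NFP _ x)|apply: (NFP _ y)]; rewrite ?exy ?eqxx ?orbT.
Qed.

(** * Choice of parameters *)

(** With [t = T / n] this is [(1 - t)^s <= 1 / (1 + s t)], cleared of denominators. *)
Lemma bernoulli_complement n T s : (n - T) ^ s * (n + s * T) <= n ^ s * n.
Proof.
elim: s => [|s IH]; first by rewrite mul0n addn0.
rewrite !expnS; apply: (@leq_trans (n * ((n - T) ^ s * (n + s * T)))); last first.
  by rewrite -mulnA leq_mul2l IH orbT.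
rewrite -[_ * _ ^ s * _]mulnA mulnCA [X in _ <= X]mulnCA leq_mul2l; apply/orP; right.
have [Tn|nT] := leqP T n; last by move/ltnW/eqP: nT => ->.
by rewrite -(subnK Tn); move: (n - T) => m; rewrite addnK; nia.
Qed.

Lemma hub_labeling_size n (e : rel 'I_n) (w : 'I_n -> 'I_n -> nat) D q :
  0 < n -> 0 < q -> q ^ 28 * maxn 1 (max_RS_edges n) <= n ^ 2 ->
  (forall x y, e x y -> w x y <= 1) -> max_degree_le e D ->
  exists S, hub_labeling e w S /\
    q ^ 4 * total_size S <= (19 + 8 * D) * n ^ 2.
Proof.
move=> n_gt0 q_gt0 q_le w1 degD.
have qk_gt0 j : 0 < q ^ j by rewrite expn_gt0 q_gt0.
have q28_le : q ^ 28 <= n ^ 2 by rewrite (leq_trans _ q_le) // leq_pmulr // leq_maxl.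
have q4_le : q ^ 4 <= n.
  have : (q ^ 4) ^ 7 <= n ^ 2 by rewrite -expnM.
  move: (q ^ 4) (qk_gt0 4) => c c_gt0 c7; rewrite leqNgt; apply/negP => nc.
  have : n ^ 2 < c ^ 2 by rewrite ltn_exp2r.
  by rewrite ltnNge (leq_trans _ c7) // leq_pexp2l.
pose s := (n %/ q ^ 4).+1; pose T := q ^ 5.
have n_le_s : n <= s * q ^ 4 by rewrite ltnW // -ltn_divLR.
have s_le : s * q ^ 4 <= 2 * n.
  by rewrite [s * _]mulSn mul2n -addnn leq_add // leq_trunc_div.
(* [q ^ 14] is [T ^ 2 * q ^ 4]; the [4 * s] greedy rounds are four blocks, each gaining a factor
   [q]. *)
have [S [b1 [b2 [S_hub S_le b1_le b2_le]]]] :=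
  hub_labeling_of_parameters (k := q ^ 14) T (4 * s) n_gt0 (qk_gt0 14) w1 degD.
exists S; split=> //.
have b2q : q ^ 4 * b2 <= n ^ 2.
  rewrite -(leq_pmul2r (qk_gt0 10)) (leq_trans _ (leq_trans b2_le _)) //.
    by rewrite mulnAC -expnD mulnC.
  by rewrite /T -expnM.
(* This follows from [s * T >= n * q]. *)
have missed : (n - T) ^ s * q <= n ^ s.
  rewrite -(leq_pmul2r n_gt0) (leq_trans _ (bernoulli_complement n T s)) //.
  rewrite -mulnA leq_mul2l; apply/orP; right.
  rewrite (leq_trans _ (leq_addl _ _)) // /T expnSr mulnA mulnC leq_mul2r n_le_s.
  by rewrite orbT.
have b1q : q ^ 4 * b1 <= n ^ 2.
  have ns_gt0 : 0 < n ^ (4 * s) by rewrite expn_gt0 n_gt0.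
  rewrite -(leq_pmul2r ns_gt0) -mulnA.
  apply: leq_trans (leq_mul (leqnn _) b1_le) _.
  rewrite mulnCA leq_mul2l mulnC [4 * s]mulnC !expnM -expnMn leq_exp2r //.
  by rewrite missed orbT.
have nq : q ^ 4 * n <= n ^ 2 by rewrite -mulnn leq_mul2r q4_le orbT.
have rq : q ^ 4 * (n * (4 * s)) <= 8 * n ^ 2.
  apply: (@leq_trans (4 * n * (s * q ^ 4))).
    by apply: eq_leq; rewrite mulnC !mulnA [n * 4]mulnC.
  by rewrite (leq_trans (leq_mul (leqnn _) s_le)) // mulnACA mulnn.
(* The exponent 28 is [4 + 14 + 10], with [10] from [T ^ 2]. *)
have RSq : q ^ 4 * (8 * q ^ 14 * T ^ 2 * max_RS_edges n) <= 8 * n ^ 2.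
  apply: (@leq_trans (8 * (q ^ 28 * max_RS_edges n))).
    rewrite /T -expnM (_ : q ^ 28 = q ^ 4 * q ^ 14 * q ^ (5 * 2)); last by rewrite -!expnD.
    move: (q ^ 4) (q ^ 14) (q ^ (5 * 2)) => x y z.
    by apply: eq_leq; rewrite !mulnA [x * 8]mulnC.
  by rewrite leq_mul2l (leq_trans _ q_le) // leq_mul2l leq_maxr orbT.
apply: leq_trans (leq_mul (leqnn (q ^ 4)) S_le) _.
rewrite !mulnDr [q ^ 4 * (_ * D.+1)]mulnA.
(* The coefficients add up to [1 + 8 + 1 + 1 + 8 * D.+1 = 19 + 8 * D]. *)
apply: (@leq_trans (n ^ 2 + 8 * n ^ 2 + n ^ 2 + n ^ 2 + 8 * n ^ 2 * D.+1)).
  by rewrite !leq_add // leq_mul2r RSq orbT.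
by move: (n ^ 2) => N; nia.
Qed.

(** * Passage to real exponents *)

Lemma INR_expn m k : INR (m ^ k) = (INR m ^ k)%R.
Proof. by elim: k => // k IH; rewrite expnS mult_INR IH. Qed.

Lemma INR_leq m k : m <= k -> (INR m <= INR k)%R.
Proof. by move=> /leP; apply: le_INR. Qed.

Lemma max_RS_edges_le n : max_RS_edges n <= n ^ 2.
Proof.
apply/bigmax_leqP => g _; apply: leq_trans (max_card _) _.
by rewrite card_prod card_ord mulnn.
Qed.

Theorem theorem5 :
  exists c : R, (0 < c <= 7)%R /\
  forall D : nat, exists CD : R,
  forall (n : nat) (e : rel 'I_n) (w : 'I_n -> 'I_n -> nat),
    symmetric e -> irreflexive e ->
    (forall x y, w x y = w y x) ->
    (forall x y, e x y -> (w x y <= 1)%N) ->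
    max_degree_le e D ->
    exists S : 'I_n -> {set 'I_n},
      hub_labeling e w S /\
      (INR (total_size S) <= CD * (INR n * INR n / Rpower (RS n) (1 / c)))%R.
Proof.
exists 7%R; split; first by lra.
(* The factor 16 is [2 ^ 4], the loss from replacing [q] by [2 * q] in [q ^ 4]. *)
move=> D; exists (INR (16 * (19 + 8 * D))) => n e w _ _ _ w1 degD.
have [n0|n_gt0] := posnP n.
  exists (fun=> set0); split; first by move=> u; have := ltn_ord u; rewrite {2}n0.
  rewrite /total_size big1 => [|u _]; last by rewrite cards0.
  by rewrite n0 /Rdiv !Rmult_0_l Rmult_0_r; apply: Rle_refl.
pose m := maxn 1 (max_RS_edges n).
have m_gt0 : 0 < m by rewrite leq_max.
have m_le : m <= n ^ 2 by rewrite geq_max expn_gt0 n_gt0 max_RS_edges_le.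
have ex_q : exists q, q ^ 28 * m <= n ^ 2 by exists 1; rewrite exp1n mul1n.
have q_bound q : q ^ 28 * m <= n ^ 2 -> q <= n ^ 2.
  move=> /(leq_trans _) -> //; case: q => // q.
  by rewrite -[X in X <= _]expn1 -[X in X <= _]muln1 leq_mul // leq_pexp2l.
case: (ex_maxnP ex_q q_bound) => q q_le q_max.
have q_gt0 : 0 < q by apply: q_max; rewrite exp1n mul1n.
have [S [S_hub S_le]] := hub_labeling_size n_gt0 q_gt0 q_le w1 degD.
exists S; split=> //.
(* Since [2 * q > q], maximality of [q] excludes [2 * q]. *)
have n2_lt : n ^ 2 < (2 * q) ^ 28 * m.
  rewrite ltnNge; apply/negP => /q_max; lia.
have posR (j : nat) : 0 < j -> (0 < INR j)%R by move=> /ltP; apply: lt_0_INR.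
have [nR mR qR] := And3 (posR _ n_gt0) (posR _ m_gt0) (posR _ q_gt0).
have RS_gt0 : (0 < RS n)%R.
  by apply: Rdiv_lt_0_compat => //; apply: Rmult_lt_0_compat.
have RS_le : (RS n <= INR (2 * q) ^ 28)%R.
  apply: (Rmult_le_reg_r (INR m)) => //.
  rewrite /RS -/m /Rdiv Rmult_assoc Rinv_l ?Rmult_1_r; last by lra.
  rewrite -INR_expn -!mult_INR; apply: INR_leq; move: (ltnW n2_lt).
  by rewrite -mulnn.
pose p := Rpower (RS n) (1 / 7).
have p_gt0 : (0 < p)%R by apply: exp_pos.
(* Here [c = 7] arises as [28 / 4]. *)
have p_le : (p <= INR (2 * q) ^ 4)%R.
  have q2 : (0 < INR (2 * q))%R by apply: posR; rewrite muln_gt0.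
  have -> : (INR (2 * q) ^ 4 = Rpower (INR (2 * q) ^ 28) (1 / 7))%R.
    rewrite -!Rpower_pow // Rpower_mult; congr Rpower.
    by rewrite !INR_IZR_INZ /=; field.
  by apply: Rle_Rpower_l; [lra|split].
apply: (Rmult_le_reg_r p) => //.
rewrite -/p /Rdiv Rmult_assoc [(_ * / p * p)%R]Rmult_assoc Rinv_l ?Rmult_1_r; last by lra.
apply: (Rle_trans _ (INR (total_size S) * INR (2 * q) ^ 4)).
  by apply: Rmult_le_compat_l => //; apply: pos_INR.
rewrite -INR_expn -!mult_INR; apply: INR_leq.
rewrite !multE mulnn mulnC expnMn -[X in X <= _]mulnA -[X in _ <= X]mulnA.
exact: (leq_mul (leqnn (2 ^ 4)) S_le).
Qed.
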